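(* Let $s>0$ and $\sigma>0$ be fixed, let $C>0$ be the constant given in the context, and let $\underline{W}_{\mathrm{eff}}^h(\varphi,z;s,\sigma)$ be the renormalized energy defined in the context for $h>0$, $\varphi\in\mathbb{R}$, $z\in(h/2,1)$. For $\varphi\in\mathbb{R}$ and $z\in(0,1)$ define $\underline{W}_{\mathrm{eff}}(\varphi,z;s,\sigma):=\lim_{h\to0^+}\underline{W}_{\mathrm{eff}}^h(\varphi,z;s,\sigma)$. Then this limit exists, and the gradient operation commutes with taking the limit as $h\to0^+$: for every $\varphi\in\mathbb{R}$ and $z\in(0,1)$, $$\nabla_{(\varphi,z)}\underline{W}_{\mathrm{eff}}(\varphi,z;s,\sigma)=\lim_{h\to0^+}\nabla_{(\varphi,z)}\underline{W}_{\mathrm{eff}}^h(\varphi,z;s,\sigma)=4Cs\begin{pmatrix}-z\bigl(sz\cos\varphi+\sigma\log z\bigr)\sin\varphi\\[1mm] sz\Bigl(\cos^2\varphi-\dfrac{1}{1-z^2}\Bigr)+\sigma(\log z+1)\cos\varphi\end{pmatrix}.$$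
   Context: Setting: the open unit disk in $\mathbb{R}^2$ contains a dipole of wedge disclinations with Frank angles $s$ and $-s$ placed at $\xi_1^h=(z,0)+\frac h2(\cos\varphi,\sin\varphi)$ and $\xi_2^h=(z,0)-\frac h2(\cos\varphi,\sin\varphi)$, and an isolated wedge disclination with Frank angle $h\sigma$ at the origin. Here $h>0$ is the dipole length, $z\in(h/2,1)$, and $s,\sigma>0$. The constant is $C=\frac{E}{16\pi(1-\nu^2)}>0$, where $E$ is Young's modulus and $\nu$ is Poisson's ratio. For fixed $z\in(0,1)$ all the expressions below are defined for $0<h<2z$. The mechanical energy at equilibrium is $\underline{W}^h=\underline{W}^h_{\mathrm{D}}+\underline{W}^h_{\mathrm{int}}+\underline{W}_{\mathrm{d}}$, where $$\underline{W}^h_{\mathrm{D}}(\varphi,z;s)=Cs^2\Bigl(2z^2\cos^2\varphi+\log\Bigl((1-z^2)^2+\tfrac{h^2}{16}\bigl(8+h^2-8z^2\cos(2\varphi)\bigr)\Bigr)\Bigr)-2Cs^2\log h,$$ $$\underline{W}^h_{\mathrm{int}}(\varphi,z;s,\sigma)=\frac{Cs\sigma}{2h}\Bigl[(h^2+4z^2)\tanh^{-1}\Bigl(\frac{4hz\cos\varphi}{h^2+4z^2}\Bigr)+2hz\cos\varphi\Bigl(\log\Bigl(z^4+\tfrac{h^2}{16}\bigl(h^2-8z^2\cos(2\varphi)\bigr)\Bigr)-2\Bigr)\Bigr],$$ $$\underline{W}_{\mathrm{d}}(\sigma)=\tfrac12C\sigma^2.$$ The diverging part is $\underline{W}^h_{\mathrm{D,div}}(s)=-2Cs^2\log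 h$, and the renormalized energy is $$\underline{W}_{\mathrm{eff}}^h(\varphi,z;s,\sigma):=\underline{W}^h(\varphi,z;s,\sigma)-\underline{W}^h_{\mathrm{D,div}}(s).$$ The symbol $\nabla_{(\varphi,z)}$ denotes the gradient with respect to $(\varphi,z)$, written as a column vector, and $\log$ is the natural logarithm. *)

(* Defs.v *)
From HB Require Import structures.
From mathcomp Require Import all_boot all_order all_algebra.
From mathcomp Require Import all_classical all_reals all_analysis.
From mathcomp Require Import ring lra.

Set Implicit Arguments.
Unset Strict Implicit.
Unset Printing Implicit Defensive.

Import Order.TTheory GRing.Theory Num.Theory.
Import numFieldNormedType.Exports.

Local Open Scope classical_set_scope.
Local Open Scope ring_scope.

Section Artanh.
Context {R : realType}.
Implicit Type x : R.

Definition tanh x : R := (expR x - expR (- x)) / (expR x + expR (- x)).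

Definition artanh x : R := ln ((1 + x) / (1 - x)) / 2.

(* tanh is a bijection from R onto ]-1, 1[, with inverse artanh *)
Lemma artanhK x : -1 < x < 1 -> tanh (artanh x) = x.
Proof.
move=> /andP[x1 x2].
have p1 : 0 < 1 + x by rewrite addrC -(opprK 1) subr_gt0.
have p2 : 0 < 1 - x by rewrite subr_gt0.
set q := (1 + x) / (1 - x).
have q0 : 0 < q by rewrite divr_gt0.
pose y := artanh x; rewrite -/y /tanh expRN.
have y0 : 0 < expR y by exact: expR_gt0.
have yy : expR y * expR y = q.
  by rewrite -expRD /y /artanh -splitr lnK.
have -> : (expR y - (expR y)^-1) / (expR y + (expR y)^-1) = (q - 1) / (q + 1).
  rewrite -yy; field.
  by rewrite !gt_eqF// addr_gt0// mulr_gt0.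
by rewrite /q; field; rewrite !gt_eqF//; lra.
Qed.

Lemma tanhK x : artanh (tanh x) = x.
Proof.
have u0 := expR_gt0 x; have v0 := expR_gt0 (- x).
rewrite /artanh /tanh.
set u := expR x in u0 *; set v := expR (- x) in v0 *.
have -> : (1 + (u - v) / (u + v)) / (1 - (u - v) / (u + v)) = u / v.
  by field; rewrite !gt_eqF//; lra.
by rewrite /u /v expRN invrK -expRD expRK; field.
Qed.

End Artanh.

Section Gradient.
Context {R : realType}.

Definition col2 (a b : R) : 'cV[R]_2 := \col_(i < 2) (if i == 0 then a else b).

Definition differentiable2 (U : R -> R -> R) (x y : R) : Prop :=
  differentiable (fun p : R * R => U p.1 p.2) (x, y).

(* the partial derivatives are total functions: grad is only meaningful
   together with differentiable2 *)
Definition grad (U : R -> R -> R) (x y : R) : 'cV[R]_2 :=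
  col2 (derive1 (fun t => U t y) x) (derive1 (fun t => U x t) y).

End Gradient.

Section Energy.
Context {R : realType}.
Implicit Types C h phi z s sigma : R.

Definition elastic_const (E nu : R) : R := E / (16 * pi * (1 - nu ^+ 2)).

Definition W_D C h phi z s : R :=
  C * s ^+ 2 *
    (2 * z ^+ 2 * cos phi ^+ 2
     + ln ((1 - z ^+ 2) ^+ 2
           + h ^+ 2 / 16 * (8 + h ^+ 2 - 8 * z ^+ 2 * cos (2 * phi))))
  - 2 * C * s ^+ 2 * ln h.

Definition W_int C h phi z s sigma : R :=
  C * s * sigma / (2 * h) *
    ((h ^+ 2 + 4 * z ^+ 2) *
       artanh (4 * h * z * cos phi / (h ^+ 2 + 4 * z ^+ 2))
     + 2 * h * z * cos phi *
       (ln (z ^+ 4 + h ^+ 2 / 16 * (h ^+ 2 - 8 * z ^+ 2 * cos (2 * phi))) - 2)).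

Definition W_d C sigma : R := 1 / 2 * C * sigma ^+ 2.

Definition W C h phi z s sigma : R :=
  W_D C h phi z s + W_int C h phi z s sigma + W_d C sigma.

Definition W_Ddiv C h s : R := - 2 * C * s ^+ 2 * ln h.

Definition W_effh C h phi z s sigma : R :=
  W C h phi z s sigma - W_Ddiv C h s.

Definition W_eff C phi z s sigma : R :=
  lim (W_effh C h phi z s sigma @[h --> 0^'+]).

End Energy.

(* Main.v *)
Require Import Defs.
From HB Require Import structures.
From mathcomp Require Import all_boot all_order all_algebra.
From mathcomp Require Import all_classical all_reals all_analysis.
From mathcomp Require Import ring lra.

Import Order.TTheory GRing.Theory Num.Theory.
Import numFieldNormedType.Exports.

Local Open Scope classical_set_scope.
Local Open Scope ring_scope.

(** The energy is built from smooth functions: for [0 < z < 1] the argument of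
    the logarithm of the dipole term is
    [(1 - z^2 + h^2/4)^2 + (h z sin phi)^2 > 0], and for [0 < h < 2 z] that of
    the interaction term is [(z^2 - h^2/4)^2 + (h z sin phi)^2 > 0], while the
    argument [X] of [artanh] satisfies [|X| < 1] because [(2 z - h)^2 > 0].  The
    gradient follows by the chain rule, and the factor [1/h] disappears from it
    except in [artanh X / h].  That is a difference quotient at [h = 0], with
    limit [cos phi / z]; everything else is continuous at [h = 0]. *)

(** * Locality of the Fréchet differential, and differentials of linear maps *)

Section IsDiff.
Set Implicit Arguments.
Context {R : numFieldType} {V W : normedModType R}.

(** The first-order expansion of [f] at [x] involves only values near [x], so it is also one for
    [g]; uniqueness of the differential then identifies ['d g x] with ['d f x]. *)
Lemma near_eq_is_diff (f g df : V -> W) (x : V) :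
  (\forall y \near x, f y = g y) -> is_diff x f df -> is_diff x g df.
Proof.
move=> fg [dfx <-].
have [cd fE] : continuous ('d f x) /\
  g \o shift x = cst (g x) + 'd f x +o_ 0 id.
  have /diff_locallyP[cd /eqaddoP fE] := dfx.
  split => //; apply/eqaddoP => e e0.
  have fg0 : \forall h \near (0 : V), f (h + x) = g (h + x).
    have : h + x @[h --> (0 : V)] --> 0 + x.
      by apply: cvgD; [exact: cvg_id|exact: cvg_cst].
    by rewrite add0r => /(_ _ fg).
  apply: filterS2 (fE e e0) fg0 => h + E.
  by rewrite /= !fctE /= E (nbhs_singleton fg).
have dgE := diff_unique cd fE.
by apply: DiffDef; rewrite ?dgE//; apply/diff_locallyP; rewrite dgE.
Qed.

Lemma is_diff_linear (f : V -> W) (x : V) :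
  linear f -> continuous f -> is_diff x f f.
Proof.
move=> fl fc; pose fM := GRing.isLinear.Build _ _ _ _ _ fl.
pose fL : {linear V -> W} := HB.pack f fM.
by apply: DiffDef; [exact: (@linear_differentiable _ _ _ fL)
                   |exact: (@diff_lin _ _ _ fL)].
Qed.

End IsDiff.

(** * Calculus rules for gradients of functions of two real variables *)

Section HasGrad.
Set Implicit Arguments.
Context {R : realType}.
Implicit Types (U V : R -> R -> R) (x y a b c d : R).

(** Fréchet differentiability rather than mere existence of the partial derivatives, so that one
    predicate yields both [differentiable2] and the value of [grad]. *)
Definition has_grad U x y a b :=
  is_diff ((x, y) : R * R) (fun p : R * R => U p.1 p.2)
    (fun v : R * R => a * v.1 + b * v.2).

Lemma has_grad_differentiable2 U x y a b :
  has_grad U x y a b -> differentiable2 U x y.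
Proof. by case. Qed.

(** The difference quotients of the two slices are those of the uncurried function along [(1, 0)]
    and [(0, 1)], where the differential takes the values [a] and [b]. *)
Lemma has_grad_is_derive U x y a b : has_grad U x y a b ->
  is_derive x 1 (U^~ y) a /\ is_derive y 1 (U x) b.
Proof.
move=> [dU dE]; set F := (fun p : R * R => U p.1 p.2) in dU dE.
have slice (f : R -> R) (t d : R) (v : R * R) :
    (fun h : R => h^-1 *: ((f \o shift t) (h *: (1 : R)) - f t)) =
    (fun h : R => h^-1 *: ((F \o shift (x, y)) (h *: v) - F (x, y))) ->
    'd F (x, y) v = d -> is_derive t 1 f d.
  move=> fF <-; apply: DeriveDef; rewrite /derivable /derive fF.
    exact: diff_derivable.
  by rewrite -deriveE.
split.
- apply: (slice _ _ _ (1, 0)); last by rewrite dE/= mulr1 mulr0 addr0.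
  apply/funext => h; rewrite /F /=; congr (_ *: (U _ _ - _)).
  by rewrite /= [_ *: 0]mulr0 add0r.
- apply: (slice _ _ _ (0, 1)); last by rewrite dE/= mulr1 mulr0 add0r.
  apply/funext => h; rewrite /F /=; congr (_ *: (U _ _ - _)).
  by rewrite /= [_ *: 0]mulr0 add0r.
Qed.

Lemma has_grad_gradE U x y a b : has_grad U x y a b -> grad U x y = col2 a b.
Proof.
by move=> /has_grad_is_derive[d1 d2]; rewrite /grad !derive1E !derive_val.
Qed.

(** Separates differentiation from algebra: the rules first produce a raw gradient in existential
    variables, which [field] or [ring] then compares with the expected one. *)
Lemma has_grad_eq U x y a b a' b' :
  has_grad U x y a b -> a = a' -> b = b' -> has_grad U x y a' b'.
Proof. by move=> + <- <-. Qed.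

Lemma has_grad_near U V x y a b :
  (\forall p \near ((x, y) : R * R), U p.1 p.2 = V p.1 p.2) ->
  has_grad U x y a b -> has_grad V x y a b.
Proof. exact: near_eq_is_diff. Qed.

Lemma has_grad_cst c x y : has_grad (fun _ _ => c) x y 0 0.
Proof.
apply: (is_diff_eq (is_diff_cst c (x, y))).
by apply/funext => v /=; rewrite !mul0r addr0.
Qed.

Lemma has_grad_fst x y : has_grad (fun t _ => t) x y 1 0.
Proof.
apply: (is_diff_eq (is_diff_linear (f := fst) (x, y) _ _)) => //.
- by move=> p; exact: cvg_fst.
- by apply/funext => v /=; rewrite mul1r mul0r addr0.
Qed.

Lemma has_grad_snd x y : has_grad (fun _ t => t) x y 0 1.
Proof.
apply: (is_diff_eq (is_diff_linear (f := snd) (x, y) _ _)) => //.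
- by move=> p; exact: cvg_snd.
- by apply/funext => v /=; rewrite mul1r mul0r add0r.
Qed.

Lemma has_gradD U V x y a b a' b' :
  has_grad U x y a b -> has_grad V x y a' b' ->
  has_grad (fun s t => U s t + V s t) x y (a + a') (b + b').
Proof.
move=> dU dV; apply: (is_diff_eq (is_diffD dU dV)).
by apply/funext => v; rewrite !fctE /=; ring.
Qed.

Lemma has_gradM U V x y a b a' b' :
  has_grad U x y a b -> has_grad V x y a' b' ->
  has_grad (fun s t => U s t * V s t) x y
    (U x y * a' + V x y * a) (U x y * b' + V x y * b).
Proof.
move=> dU dV; apply: (is_diff_eq (is_diffM dU dV)).
by apply/funext => v; rewrite !fctE /GRing.scale /=; ring.
Qed.

Lemma has_grad_comp (f : R -> R) d U x y a b :
  is_derive (U x y) 1 f d -> has_grad U x y a b ->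
  has_grad (fun s t => f (U s t)) x y (d * a) (d * b).
Proof.
move=> [df fE] dU.
have dF : is_diff (U x y) f (fun h => h * d).
  apply: DiffDef; first exact/derivable1_diffP.
  by rewrite deriv1E// derive1E fE.
apply: (is_diff_eq (is_diff_comp (f := fun p => U p.1 p.2) dU dF)).
by apply/funext => v /=; ring.
Qed.

Lemma has_gradN U x y a b :
  has_grad U x y a b -> has_grad (fun s t => - U s t) x y (- a) (- b).
Proof.
move=> dU; apply: (is_diff_eq (is_diffN dU)).
by apply/funext => v; rewrite !fctE /=; ring.
Qed.

Lemma has_gradX n U x y a b :
  has_grad U x y a b ->
  has_grad (fun s t => U s t ^+ n) x y
    (n%:R * U x y ^+ n.-1 * a) (n%:R * U x y ^+ n.-1 * b).
Proof.
apply: (has_grad_comp (f := fun t => t ^+ n)).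
apply: DeriveDef; first exact: exprn_derivable.
by rewrite exp_derive /GRing.scale/= mulr1.
Qed.

Lemma has_gradV U x y a b :
  U x y != 0 -> has_grad U x y a b ->
  has_grad (fun s t => (U s t)^-1) x y
    (- (U x y) ^- 2 * a) (- (U x y) ^- 2 * b).
Proof.
move=> U0; apply: (has_grad_comp (f := GRing.inv)).
have := is_deriveV U0 (@is_derive_id _ R (U x y) 1).
by rewrite /GRing.scale/= mulr1.
Qed.

Lemma has_grad_ln U x y a b :
  0 < U x y -> has_grad U x y a b ->
  has_grad (fun s t => ln (U s t)) x y ((U x y)^-1 * a) ((U x y)^-1 * b).
Proof. by move=> U0; apply: has_grad_comp; exact: is_derive1_ln. Qed.

Lemma has_grad_cos U x y a b :
  has_grad U x y a b ->
  has_grad (fun s t => cos (U s t)) x y (- sin (U x y) * a) (- sin (U x y) * b).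
Proof. by apply: has_grad_comp; exact: is_derive_cos. Qed.

End HasGrad.

(** * Derivative of the inverse hyperbolic tangent *)

Section ArtanhDerivative.
Context {R : realType}.
Implicit Types x : R.

Lemma is_derive1_artanh x : -1 < x < 1 ->
  is_derive x 1 (@artanh R) (1 - x ^+ 2)^-1.
Proof.
move=> /andP[x1 x2].
have p1 : 0 < 1 + x by lra.
have p2 : 0 < 1 - x by lra.
have q0 : 0 < (1 + x) / (1 - x) by rewrite divr_gt0.
have c1 := is_derive_cst (1 : R) x 1.
have d1 : is_derive x 1 (fun t => 1 + t) 1.
  apply: (is_derive_eq (is_deriveD c1 (is_derive_id x 1))).
  exact: add0r.
have d2 : is_derive x 1 (fun t => 1 - t) (-1).
  apply: (is_derive_eq (is_deriveB c1 (is_derive_id x 1))).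
  exact: sub0r.
have dV := @is_deriveV _ (fun t => 1 - t) _ _ _ (lt0r_neq0 p2) d2.
have d3 := is_deriveM d1 dV.
have d4 := @is_derive1_comp _ (@ln R) _ x _ _ (is_derive1_ln q0) d3.
apply: (is_derive_eq (is_deriveM d4 (is_derive_cst (2^-1 : R) x 1))).
rewrite /GRing.scale/= mulr0 add0r; field.
have p3 : 0 < 1 - x ^+ 2 by nra.
by rewrite !gt_eqF.
Qed.

Lemma has_grad_artanh (U : R -> R -> R) (x y a b : R) :
  -1 < U x y < 1 -> has_grad U x y a b ->
  has_grad (fun s t => artanh (U s t)) x y
    ((1 - U x y ^+ 2)^-1 * a) ((1 - U x y ^+ 2)^-1 * b).
Proof. by move=> U1; apply: has_grad_comp; exact: is_derive1_artanh. Qed.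

End ArtanhDerivative.

(** The order matters: constants come before the structural rules, so that no constant factor is
    split, and [eassumption] lets known gradients and sign conditions be used as they are. *)
Ltac has_grad_tac :=
  repeat first [ exact: has_grad_cst | exact: has_grad_fst | exact: has_grad_snd
  | eassumption
  | eapply has_gradD | eapply has_gradN | eapply has_gradX
  | eapply has_grad_ln | eapply has_grad_cos | eapply has_grad_artanh
  | eapply has_gradV | eapply has_gradM ].

(** * Positivity of the arguments and the gradient of the energy for fixed [h] *)

Section EnergyGradient.
Set Implicit Arguments.
Context {R : realType}.
Implicit Types C h phi z s sigma : R.

Definition logargD h phi z :=
  (1 - z ^+ 2) ^+ 2 + h ^+ 2 / 16 * (8 + h ^+ 2 - 8 * z ^+ 2 * cos (2 * phi)).

Definition logargI h phi z :=
  z ^+ 4 + h ^+ 2 / 16 * (h ^+ 2 - 8 * z ^+ 2 * cos (2 * phi)).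

Definition artanharg h phi z := 4 * h * z * cos phi / (h ^+ 2 + 4 * z ^+ 2).

Lemma cos2x phi : cos (2 * phi) = 1 - 2 * sin phi ^+ 2.
Proof. by rewrite mulr_natl cos_mulr2n cos2sin2 -mulr_natl; ring. Qed.

Lemma logargD_gt0 h phi z : 0 < z < 1 -> 0 < logargD h phi z.
Proof.
move=> /andP[z0 z1].
have -> : logargD h phi z =
    (1 - z ^+ 2 + h ^+ 2 / 4) ^+ 2 + (h * z * sin phi) ^+ 2.
  by rewrite /logargD cos2x; field.
have z2 : 0 < 1 - z ^+ 2 by nra.
have h2 : 0 <= h ^+ 2 / 4 by rewrite divr_ge0// sqr_ge0.
by rewrite ltr_pwDl ?sqr_ge0// exprn_gt0// ltr_pwDl.
Qed.

Lemma logargI_gt0 h phi z : 0 < h < 2 * z -> 0 < logargI h phi z.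
Proof.
move=> /andP[h0 hz].
have -> : logargI h phi z = (z ^+ 2 - h ^+ 2 / 4) ^+ 2 + (h * z * sin phi) ^+ 2.
  by rewrite /logargI cos2x; field.
rewrite ltr_pwDl ?sqr_ge0// exprn_gt0//; nra.
Qed.

Lemma artanharg_itv h phi z : 0 < h < 2 * z -> -1 < artanharg h phi z < 1.
Proof.
move=> /andP[h0 hz].
have D0 : 0 < h ^+ 2 + 4 * z ^+ 2 by nra.
have /andP[c1 c2] : -1 <= cos phi <= 1 by rewrite cos_geN1 cos_le1.
rewrite /artanharg ltr_pdivlMr// ltr_pdivrMr// mulN1r mul1r.
have z0 : 0 < z by nra.
have hz0 : 0 < h * z by rewrite mulr_gt0.
(* As [|cos phi| <= 1], both bounds reduce to [4 h z < h^2 + 4 z^2], which is this inequality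
   expanded. *)
have d0 : 0 < (2 * z - h) ^+ 2 by rewrite exprn_gt0// subr_gt0.
have u1 : h * z * cos phi <= h * z by rewrite ler_piMr// ltW.
have u2 : - (h * z) <= h * z * cos phi by rewrite -mulrN1 ler_pM2l.
by apply/andP; split; nra.
Qed.

Lemma has_grad_logargD h phi z :
  has_grad (logargD h) phi z
    (h ^+ 2 * z ^+ 2 * sin (2 * phi))
    (- 4 * z * (1 - z ^+ 2) - h ^+ 2 * z * cos (2 * phi)).
Proof.
apply: has_grad_eq; rewrite /logargD; first by has_grad_tac.
- by rewrite /=; field.
- by rewrite /=; field.
Qed.

Lemma has_grad_logargI h phi z :
  has_grad (logargI h) phi z
    (h ^+ 2 * z ^+ 2 * sin (2 * phi))
    (4 * z ^+ 3 - h ^+ 2 * z * cos (2 * phi)).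
Proof.
apply: has_grad_eq; rewrite /logargI; first by has_grad_tac.
- by rewrite /=; field.
- by rewrite /=; field.
Qed.

Lemma has_grad_artanharg h phi z : 0 < h ^+ 2 + 4 * z ^+ 2 ->
  has_grad (artanharg h) phi z
    (- 4 * h * z * sin phi / (h ^+ 2 + 4 * z ^+ 2))
    (4 * h * cos phi * (h ^+ 2 - 4 * z ^+ 2) / (h ^+ 2 + 4 * z ^+ 2) ^+ 2).
Proof.
move=> D0.
apply: has_grad_eq; rewrite /artanharg; first by has_grad_tac; rewrite gt_eqF.
- by rewrite /=; field; rewrite gt_eqF.
- by rewrite /=; field; rewrite gt_eqF.
Qed.

(** No [1/h] is left: each [phi]-derivative in the interaction bracket carries a factor [h], and
    [h^2 + 4 z^2] cancels against the denominator of [artanharg]. *)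
Definition dphi_W_effh C h phi z s sigma :=
  C * s ^+ 2 * (- 4 * z ^+ 2 * cos phi * sin phi
                + h ^+ 2 * z ^+ 2 * sin (2 * phi) / logargD h phi z)
  + C * s * sigma / 2 *
    (- 4 * z * sin phi / (1 - artanharg h phi z ^+ 2)
     - 2 * z * sin phi * (ln (logargI h phi z) - 2)
     + 2 * z * cos phi * (h ^+ 2 * z ^+ 2 * sin (2 * phi) / logargI h phi z)).

(** Differentiating the factor [h^2 + 4 z^2] leaves [artanh X / h], kept as a single quotient
    because only the quotient has a limit that can be used. *)
Definition dz_W_effh C h phi z s sigma :=
  C * s ^+ 2 * (4 * z * cos phi ^+ 2
                + (- 4 * z * (1 - z ^+ 2) - h ^+ 2 * z * cos (2 * phi))
                  / logargD h phi z)
  + C * s * sigma / 2 *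
    (8 * z * (artanh (artanharg h phi z) / h)
     + 4 * cos phi * (h ^+ 2 - 4 * z ^+ 2) / (h ^+ 2 + 4 * z ^+ 2)
       / (1 - artanharg h phi z ^+ 2)
     + 2 * cos phi * (ln (logargI h phi z) - 2)
     + 2 * z * cos phi * ((4 * z ^+ 3 - h ^+ 2 * z * cos (2 * phi))
                          / logargI h phi z)).

Lemma has_grad_W_effh C h phi z s sigma : 0 < z < 1 -> 0 < h < 2 * z ->
  has_grad (fun x y => W_effh C h x y s sigma) phi z
    (dphi_W_effh C h phi z s sigma) (dz_W_effh C h phi z s sigma).
Proof.
move=> z01 hz; rewrite /dphi_W_effh /dz_W_effh.
set A := logargD h phi z; set B := logargI h phi z; set X := artanharg h phi z.
have /andP[h0 _] := hz.
have A0 : 0 < A by exact: logargD_gt0.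
have B0 : 0 < B by exact: logargI_gt0.
have X1 : -1 < X < 1 by exact: artanharg_itv.
have X2 : 0 < 1 - X ^+ 2 by nra.
have D0 : 0 < h ^+ 2 + 4 * z ^+ 2 by nra.
have dA := has_grad_logargD h phi z.
have dB := has_grad_logargI h phi z.
have dX := has_grad_artanharg h phi z D0.
apply: has_grad_eq; rewrite /W_effh /W /W_D /W_int /W_d /W_Ddiv.
(* The energy is folded back in terms of [logargD], [logargI] and [artanharg], so that
   [has_grad_tac] uses [dA], [dB] and [dX] for them. *)
- rewrite -[X in has_grad X]/(fun x y : R =>
    C * s ^+ 2 * (2 * y ^+ 2 * cos x ^+ 2 + ln (logargD h x y))
    - 2 * C * s ^+ 2 * ln h
    + C * s * sigma / (2 * h) *
      ((h ^+ 2 + 4 * y ^+ 2) * artanh (artanharg h x y)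
       + 2 * h * y * cos x * (ln (logargI h x y) - 2))
    + 1 / 2 * C * sigma ^+ 2 - - 2 * C * s ^+ 2 * ln h).
  by has_grad_tac.
- rewrite -/A -/B -/X /=; field.
  by rewrite !gt_eqF.
- rewrite -/A -/B -/X /=; field.
  by rewrite !gt_eqF.
Qed.

End EnergyGradient.

(** * Limit rules for functions written pointwise *)

Section CvgLambda.
Set Implicit Arguments.
Context {R : realType} {T : Type} {F : set_system T} {FF : Filter F}.
Implicit Types (f g : T -> R) (a b : R).

Lemma cvg_to_eq f a b : f x @[x --> F] --> a -> a = b -> f x @[x --> F] --> b.
Proof. by move=> ? <-. Qed.

Lemma cvg_add f g a b : f x @[x --> F] --> a -> g x @[x --> F] --> b ->
  (f x + g x) @[x --> F] --> a + b.
Proof. exact: cvgD. Qed.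

Lemma cvg_mul f g a b : f x @[x --> F] --> a -> g x @[x --> F] --> b ->
  (f x * g x) @[x --> F] --> a * b.
Proof. exact: cvgM. Qed.

Lemma cvg_opp f a : f x @[x --> F] --> a -> (- f x) @[x --> F] --> - a.
Proof. exact: cvgN. Qed.

Lemma cvg_inv f a : a != 0 -> f x @[x --> F] --> a ->
  (f x)^-1 @[x --> F] --> a^-1.
Proof. by move=> a0 fa; exact: cvgV. Qed.

Lemma cvg_expr n f a : f x @[x --> F] --> a -> f x ^+ n @[x --> F] --> a ^+ n.
Proof. exact: (continuous_cvg _ (@exprn_continuous R n a)). Qed.

Lemma cvg_ln f a : 0 < a -> f x @[x --> F] --> a ->
  ln (f x) @[x --> F] --> ln a.
Proof. by move=> a0 fa; exact: (continuous_cvg _ (continuous_ln a0) fa). Qed.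

End CvgLambda.

(* The dispatch on the head symbol avoids unification problems such as
   [?f x + ?g x = x ^+ 2], which take very long to fail. *)
Ltac cvg_tac := first [ exact: cvg_cst |
  lazymatch goal with |- cvg_to (nbhs (fmap ?f _)) _ =>
    lazymatch f with
    | fun x => @Algebra.add _ _ _ => eapply cvg_add; [cvg_tac|cvg_tac]
    | fun x => @Algebra.opp _ _ => eapply cvg_opp; cvg_tac
    | fun x => @GRing.mul _ (artanh _) _ => eassumption
    | fun x => @GRing.mul _ _ _ => eapply cvg_mul; [cvg_tac|cvg_tac]
    | fun x => @GRing.exp _ _ _ => eapply cvg_expr; cvg_tac
    | fun x => @GRing.inv _ _ => eapply cvg_inv; [|cvg_tac]
    | fun x => ln _ => eapply cvg_ln; [|cvg_tac]
    | _ => eassumption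
    end
  end ].

(** * Limits of the energy and of its gradient as [h] tends to 0 from the right *)

Section Limits.
Set Implicit Arguments.
Context {R : realType}.
Implicit Types C h phi z s sigma : R.

Lemma cvg_logargD phi z :
  logargD h phi z @[h --> 0^'+] --> (1 - z ^+ 2) ^+ 2.
Proof.
have h0 : h @[h --> (0 : R)^'+] --> (0 : R) by exact/cvg_at_right_filter/cvg_id.
by apply: cvg_to_eq; [rewrite /logargD; cvg_tac|ring].
Qed.

Lemma cvg_logargI phi z :
  logargI h phi z @[h --> 0^'+] --> z ^+ 4.
Proof.
have h0 : h @[h --> (0 : R)^'+] --> (0 : R) by exact/cvg_at_right_filter/cvg_id.
by apply: cvg_to_eq; [rewrite /logargI; cvg_tac|ring].
Qed.

Lemma cvg_artanharg phi z : z != 0 ->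
  artanharg h phi z @[h --> 0^'+] --> 0.
Proof.
move=> z0.
have h0 : h @[h --> (0 : R)^'+] --> (0 : R) by exact/cvg_at_right_filter/cvg_id.
apply: cvg_to_eq.
  rewrite /artanharg; cvg_tac.
  by rewrite expr0n/= add0r mulf_neq0// expf_neq0.
by rewrite mulr0 !mul0r.
Qed.

Lemma artanh0 : artanh (0 : R) = 0.
Proof. by rewrite /artanh addr0 subr0 divr1 ln1 mul0r. Qed.

Lemma cvg_artanh_ratio phi z : z != 0 ->
  artanh (artanharg h phi z) / h @[h --> 0^'+] --> cos phi / z.
Proof.
move=> z0.
have D0 : (0 ^+ 2 + 4 * z ^+ 2 : R) != 0.
  by rewrite expr0n/= add0r mulf_neq0// expf_neq0.
have X0 : artanharg 0 phi z = 0 by rewrite /artanharg mulr0 !mul0r.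
have [dX _] :
    is_derive (0 : R) 1 (fun h => artanh (artanharg h phi z)) (cos phi / z) /\
    is_derive (0 : R) 1 (fun=> artanh (artanharg 0 phi z)) 0.
  (* The function of [h] is seen as one of two variables, constant in the second, so that the
     gradient rules apply; its derivative at 0 is [4 z cos phi / (4 z^2)]. *)
  apply: (@has_grad_is_derive _ (fun h _ => artanh (artanharg h phi z))).
  have X1 : -1 < artanharg 0 phi z < 1 by rewrite X0 ltrN10 ltr01.
  apply: has_grad_eq.
  - apply: has_grad_artanh => //; rewrite /artanharg; has_grad_tac.
  - by rewrite /= X0; field.
  - rewrite /=; ring.
have [dl lE] := dX.
rewrite /derivable in dl; rewrite /derive in lE.
have := cvg_dnbhs_at_right dl; rewrite lE.
rewrite (_ : (fun h : R => h^-1 *: _) =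
             (fun h => artanh (artanharg h phi z) / h))//.
apply/funext => h /=.
by rewrite X0 artanh0 subr0 addr0 [_%:A]mulr1 [LHS]mulrC.
Qed.

(** In the limit the [artanh] term contributes [2 C s sigma z cos phi], which cancels the [- 2] next
    to the logarithm; [ln (z^4) = 4 ln z] gives the rest of the interaction. *)
Definition W_lim C phi z s sigma :=
  C * s ^+ 2 * (2 * z ^+ 2 * cos phi ^+ 2 + 2 * ln (1 - z ^+ 2))
  + 4 * C * s * sigma * (z * ln z * cos phi) + W_d C sigma.

Lemma near_right_itv z : 0 < z -> \forall h \near 0^'+, 0 < h < 2 * z.
Proof.
move=> z0; near=> h; apply/andP; split; near: h.
  exact: nbhs_right_gt.
by apply: nbhs_right_lt; rewrite mulr_gt0.
Unshelve. all: by end_near. Qed.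

Lemma cvg_W_effh C phi z s sigma : 0 < z < 1 ->
  W_effh C h phi z s sigma @[h --> 0^'+] --> W_lim C phi z s sigma.
Proof.
move=> /andP[z0 z1].
have z2 : 0 < 1 - z ^+ 2 by nra.
have z_neq0 : z != 0 by rewrite gt_eqF.
have h0 : h @[h --> (0 : R)^'+] --> (0 : R) by exact/cvg_at_right_filter/cvg_id.
have cA := cvg_logargD phi z.
have cB := cvg_logargI phi z.
have cX := @cvg_artanh_ratio phi z z_neq0.
(* The energy with the [ln h] terms cancelled and [1/h] moved onto [artanh]. It is matched with
   [W_effh] below for [h > 0] only, which suffices for a right limit. *)
have cW : (C * s ^+ 2 * (2 * z ^+ 2 * cos phi ^+ 2 + ln (logargD h phi z))
    + C * s * sigma / 2 *
      ((h ^+ 2 + 4 * z ^+ 2) * (artanh (artanharg h phi z) / h)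
       + 2 * z * cos phi * (ln (logargI h phi z) - 2))
    + W_d C sigma) @[h --> 0^'+] --> W_lim C phi z s sigma.
  apply: cvg_to_eq; first by cvg_tac; rewrite exprn_gt0.
  by rewrite /W_lim !lnXn//; field.
apply: cvg_trans cW; apply: near_eq_cvg.
near=> h.
have hgt0 : 0 < h by near: h; exact: nbhs_right_gt.
rewrite /W_effh /W /W_D /W_int /W_Ddiv -/(logargD h phi z) -/(logargI h phi z).
by rewrite -/(artanharg h phi z); field; rewrite gt_eqF.
Unshelve. all: by end_near. Qed.

(** A column is a linear combination of the two basis columns, so convergence of the entries passes
    through scaling and addition. *)
Lemma cvg_col2 {T : Type} (F : set_system T) {FF : Filter F}
    (f g : T -> R) (a b : R) :
  f x @[x --> F] --> a -> g x @[x --> F] --> b ->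
  col2 (f x) (g x) @[x --> F] --> col2 a b.
Proof.
have colE (u v : R) : col2 u v = u *: col2 1 0 + v *: col2 0 1.
  apply/matrixP => i j; rewrite !mxE.
  by case: ifP => _; rewrite mulr0 mulr1 ?addr0 ?add0r.
move=> fa gb; rewrite colE.
under eq_fun do rewrite colE.
by apply: cvgD; apply: cvgZr_tmp.
Qed.

Lemma near_snd_itv01 phi z : 0 < z < 1 ->
  \forall p \near ((phi, z) : R * R), 0 < p.2 < 1.
Proof.
move=> /andP[z0 z1].
have zn : \forall y \near z, 0 < y < 1.
  by apply: filterS2 (lt_nbhsr z0) (lt_nbhsl z1) => y -> ->.
exact: (@cvg_snd _ _ (nbhs phi) (nbhs z) _ _ zn).
Qed.

Lemma has_grad_W_eff C phi z s sigma : 0 < z < 1 ->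
  has_grad (fun x y => W_eff C x y s sigma) phi z
    (4 * C * s * (- z * (s * z * cos phi + sigma * ln z) * sin phi))
    (4 * C * s * (s * z * (cos phi ^+ 2 - 1 / (1 - z ^+ 2))
                  + sigma * (ln z + 1) * cos phi)).
Proof.
move=> z01; have /andP[z0 z1] := z01.
have z2 : 0 < 1 - z ^+ 2 by nra.
(* [W_eff] is a [lim], identified with [W_lim] only for [0 < z < 1]; this condition is open, so the
   two agree near the point and share their gradient. *)
apply: (@has_grad_near _ (fun x y => W_lim C x y s sigma)).
  near=> p; have p01 : 0 < p.2 < 1 by near: p; exact: near_snd_itv01.
  have cW := @cvg_W_effh C p.1 p.2 s sigma p01.
  by rewrite /W_eff (cvg_lim (@Rhausdorff R) cW).
apply: has_grad_eq; first by rewrite /W_lim; has_grad_tac.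
- by rewrite /=; field; rewrite !gt_eqF.
- by rewrite /=; field; rewrite !gt_eqF.
Unshelve. all: by end_near. Qed.

Lemma cvg_grad_W_effh C phi z s sigma : 0 < z < 1 ->
  grad (fun x y => W_effh C h x y s sigma) phi z @[h --> 0^'+] -->
  col2 (4 * C * s * (- z * (s * z * cos phi + sigma * ln z) * sin phi))
    (4 * C * s * (s * z * (cos phi ^+ 2 - 1 / (1 - z ^+ 2))
                  + sigma * (ln z + 1) * cos phi)).
Proof.
move=> z01; have /andP[z0 z1] := z01.
have z2 : 0 < 1 - z ^+ 2 by nra.
have z_neq0 : z != 0 by rewrite gt_eqF.
have h0 : h @[h --> (0 : R)^'+] --> (0 : R) by exact/cvg_at_right_filter/cvg_id.
have cA := cvg_logargD phi z.
have cB := cvg_logargI phi z.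
have cX := @cvg_artanharg phi z z_neq0.
have cR := @cvg_artanh_ratio phi z z_neq0.
(* The powers of 0 stay unreduced here and in [X0], to match the side conditions that [cvg_tac]
   produces. *)
have D0 : 0 ^+ 2 + 4 * z ^+ 2 != 0 :> R.
  by rewrite expr0n/= add0r mulf_neq0// expf_neq0.
have X0 : 1 - 0 ^+ 2 != 0 :> R by rewrite expr0n/= subr0 oner_neq0.
have A0 : (1 - z ^+ 2) ^+ 2 != 0 by rewrite expf_neq0// gt_eqF.
have B0 : z ^+ 4 != 0 by rewrite expf_neq0.
have B1 : 0 < z ^+ 4 by rewrite exprn_gt0.
have cG : col2 (dphi_W_effh C h phi z s sigma) (dz_W_effh C h phi z s sigma)
    @[h --> 0^'+] -->
  col2 (4 * C * s * (- z * (s * z * cos phi + sigma * ln z) * sin phi))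
    (4 * C * s * (s * z * (cos phi ^+ 2 - 1 / (1 - z ^+ 2))
                  + sigma * (ln z + 1) * cos phi)).
  rewrite /dphi_W_effh /dz_W_effh; apply: cvg_col2.
  - apply: cvg_to_eq; first by cvg_tac; eassumption.
    by rewrite lnXn//; field; rewrite !gt_eqF.
  - apply: cvg_to_eq; first by cvg_tac; eassumption.
    by rewrite lnXn//; field; rewrite z_neq0 gt_eqF.
(* The explicit formulas give the gradient only for [0 < h < 2 z], which holds eventually as [h]
   decreases to 0. *)
apply: cvg_trans cG; apply: near_eq_cvg; near=> h.
rewrite (has_grad_gradE (@has_grad_W_effh _ C h phi z s sigma z01 _))//.
by near: h; exact: near_right_itv.
Unshelve. all: by end_near. Qed.

End Limits.

Theorem proposition2p2 (R : realType) (E nu C s sigma : R)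
    (C_def : C = elastic_const E nu)
    (C_gt0 : 0 < C) (s_gt0 : 0 < s) (sigma_gt0 : 0 < sigma) :
  forall phi z : R, 0 < z < 1 ->
  [/\ cvg (W_effh C h phi z s sigma @[h --> 0^'+]),
      differentiable2 (fun x y => W_eff C x y s sigma) phi z
        /\ (forall h : R, 0 < h < 2 * z ->
              differentiable2 (fun x y => W_effh C h x y s sigma) phi z),
      cvg (grad (fun x y => W_effh C h x y s sigma) phi z @[h --> 0^'+]),
      grad (fun x y => W_eff C x y s sigma) phi z =
        lim (grad (fun x y => W_effh C h x y s sigma) phi z @[h --> 0^'+])
    & lim (grad (fun x y => W_effh C h x y s sigma) phi z @[h --> 0^'+]) =
        (4 * C * s) *:
          col2 (- z * (s * z * cos phi + sigma * ln z) * sin phi)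
               (s * z * (cos phi ^+ 2 - 1 / (1 - z ^+ 2))
                + sigma * (ln z + 1) * cos phi)].
Proof.
move=> phi z z01.
have cW := @cvg_W_effh _ C phi z s sigma z01.
have dW := @has_grad_W_eff _ C phi z s sigma z01.
have cG := @cvg_grad_W_effh _ C phi z s sigma z01.
(* The space of columns is Hausdorff, so [lim] is the limit just found. *)
have limG := cvg_lim (@norm_hausdorff _ _) cG.
split.
- by apply/cvg_ex; eexists; exact: cW.
- split; first exact: has_grad_differentiable2 dW.
  by move=> h hz; apply: has_grad_differentiable2; exact: has_grad_W_effh.
- by apply/cvg_ex; eexists; exact: cG.
- by rewrite limG (has_grad_gradE dW).
- rewrite limG; apply/matrixP => i j; rewrite !mxE.
  by case: ifP.
Qed.
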